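(* Let $i\in\{1,2\}$, let $W\in\mathbf{R}^{n\times n}$ be symmetric positive definite and let $\rho_k^i\ge\|\Pi_{ki}\|_i^2$ ($k=0,\dots,\nu$) be real constants. The three lower estimations GFMB, S-GFMB and BBI of $\langle f_i,Wf_i\rangle_i$ (defined in the context) are equivalent, and the tightest one is obtained under the choice of free parameters yielding BBI. That is, for every $f\in\mathbb{E}_0^n$: (i) $R_{\mathrm{GFMB}}(\Psi^i,\chi,f)\le R_{\mathrm{BBI}}(f)$ for every admissible $\Psi^i$ and $\chi\in\mathbf{R}^{M_2}$, and equality holds for some admissible $\Psi^i$ and some $\chi$; (ii) $R_{\mathrm{S}}(N^i,\chi,f)\le R_{\mathrm{BBI}}(f)$ for every $N_0^i,\dots,N_\nu^i\in\mathbf{R}^{M_2\times n}$ and $\chi\in\mathbf{R}^{M_2}$, and equality holds for some $N_0^i,\dots,N_\nu^i$ and some $\chi$.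
   Context: For $i=0,1,2$, $\mathbb{E}_i$ is a real inner product space (not assumed complete) of functions $\varphi:D_i\to\mathbf{R}$, $D_i\subset\mathbf{R}$, with inner product $\langle\cdot,\cdot\rangle_i$ and norm $\|\cdot\|_i$, containing the constant function $\Pi_{0i}\equiv1$ and such that: (P1) if $\varphi,\psi\in\mathbb{E}_i$ then $\varphi\psi\in\mathbb{E}_i$ and $\langle\varphi,\psi\rangle_i=\langle\Pi_{0i},\varphi\psi\rangle_i$; (P2) if $\varphi\in\mathbb{E}_i$ and $\varphi(t)\ge0$ for all $t\in D_i$, then $\langle\Pi_{0i},\varphi\rangle_i\ge0$. Moreover $D_1\cap D_2=\emptyset$, $D_1\cup D_2=D_0$, restrictions to $D_i$ ($i=1,2$) of elements of $\mathbb{E}_0$ belong to $\mathbb{E}_i$, and $\langle\varphi,\psi\rangle_0=\langle\varphi_1,\psi_1\rangle_1+\langle\varphi_2,\psi_2\rangle_2$, where the subscript $i$ on a function denotes its restriction to $D_i$. $\nu\ge0$ and $n\ge1$ are integers, and $\Pi_{0i},\Pi_{1i},\dots,\Pi_{\nu i}$ is an orthogonal system (of nonzero elements) in $\mathbb{E}_i$. $M_1=(\nu+1)n$, $M_2=2M_1$. For $f\in\mathbb{E}_0^n$, $f_i$ is its restriction to $D_i$; $\langle f_i,\varphi\rangle_i\in\mathbf{R}^n$ is taken componentwise; $\langle f_i,Wf_i\rangle_i=\sum_{a,b}W_{ab}\langle f_i^{(a)},f_i^{(b)}\rangle_i$. Define $\underline{w}^i=\mathrm{col}\{\langle f_i,\Pi_{0i}\rangle_i,\dots,\langle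 f_i,\Pi_{\nu i}\rangle_i\}\in\mathbf{R}^{M_1}$ and $\underline{w}=\mathrm{col}\{\underline{w}^1,\underline{w}^2\}\in\mathbf{R}^{M_2}$. $\mathrm{He}(A)=A+A^T$. Given $N_k^i\in\mathbf{R}^{M_2\times n}$, put $N^1=(N_0^1,\dots,N_\nu^1,0,\dots,0)$ and $N^2=(0,\dots,0,N_0^2,\dots,N_\nu^2)$, both in $\mathbf{R}^{M_2\times M_2}$. An admissible $\Psi^i$ is a symmetric positive semidefinite matrix $$\Psi^i=\begin{bmatrix} Z_{00}^i&\cdots&Z_{0\nu}^i&N_0^i\\ \vdots&\ddots&\vdots&\vdots\\ Z_{\nu0}^i&\cdots&Z_{\nu\nu}^i&N_\nu^i\\ (N_0^i)^T&\cdots&(N_\nu^i)^T&W\end{bmatrix}\ge0,\qquad Z_{kl}^i\in\mathbf{R}^{M_2\times M_2}.$$ Let $\mathcal{W}_i=\mathrm{diag}\{1/\rho_0^i,\dots,1/\rho_\nu^i\}\otimes W$, $\mathcal{W}_{i-}=\mathcal{W}_i^{-1}$, $\widehat{\mathcal{W}}_{1-}=\mathrm{diag}(\mathcal{W}_{1-},0)$, $\widehat{\mathcal{W}}_{2-}=\mathrm{diag}(0,\mathcal{W}_{2-})$ (in $\mathbf{R}^{M_2\times M_2}$). The estimations are $\langle f_i,Wf_i\rangle_i\ge R$ with, respectively: GFMB: $R_{\mathrm{GFMB}}(\Psi^i,\chi,f)=-\chi^T\big(\sum_{k=0}^\nu\rho_k^iZ_{kk}^i\big)\chi-\mathrm{He}(\chi^TN^i\underline{w})$,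 for admissible $\Psi^i$ and $\chi\in\mathbf{R}^{M_2}$; S-GFMB: $R_{\mathrm{S}}(N^i,\chi,f)=-\mathrm{He}(\chi^TN^i\underline{w})-\chi^TN^i\widehat{\mathcal{W}}_{i-}(N^i)^T\chi$, for arbitrary $N_k^i$ and $\chi\in\mathbf{R}^{M_2}$; BBI: $R_{\mathrm{BBI}}(f)=(\underline{w}^i)^T\mathcal{W}_i\,\underline{w}^i$. *)

(* Defs.v *)
From HB Require Import structures.
From mathcomp Require Import all_boot all_order all_algebra.
From mathcomp Require Import mathcomp_extra boolp classical_sets functions reals.
From mathcomp Require Import mxtens.

Set Implicit Arguments.
Unset Strict Implicit.
Unset Printing Implicit Defensive.

Import Order.TTheory GRing.Theory Num.Theory.
Local Open Scope classical_set_scope.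
Local Open Scope ring_scope.

(* Real inner product spaces of functions on D, not assumed complete. The form
   is a total function whose values are meaningful on the carrier only. The
   constant function 1 is [cst 1]. *)
Record funIPS (R : realType) (D : set R) := FunIPS {
  carrier :> set (D -> R) ;
  ip : (D -> R) -> (D -> R) -> R ;
  carrier0 : cst 0 \in carrier ;
  carrierL : forall a : R, {in carrier &, forall u v, a \*o u \+ v \in carrier} ;
  ip_sym : {in carrier &, forall u v, ip u v = ip v u} ;
  ip_linear : forall a : R, {in carrier & &,
    forall u v w, ip (a \*o u \+ v) w = a * ip u w + ip v w} ;
  ip_ge0 : {in carrier, forall u, 0 <= ip u u} ;
  ip_def : {in carrier, forall u, ip u u = 0 -> u = cst 0} ;
  carrier1 : cst 1 \in carrier ;
  carrierM : {in carrier &, forall u v, u \* v \in carrier} ;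
  ipM : {in carrier &, forall u v, ip u v = ip (cst 1) (u \* v)} ;
  ip1_ge0 : {in carrier, forall u, (forall t, 0 <= u t) -> 0 <= ip (cst 1) u} }.

Definition ipnorm (R : realType) (D : set R) (E : funIPS D) (u : D -> R) : R :=
  Num.sqrt (ip E u u).

Definition restr (R : realType) (A B : set R) (AB : A `<=` B) (u : B -> R) :
  A -> R := fun t => u (SigSub (mem_set (AB _ (set_valP t)))).

(* Indices i = 1, 2 are represented by [ord0, ord_max : 'I_2]. *)
Lemma part_sub (R : realType) (D0 : set R) (D : 'I_2 -> set R) :
  D ord0 `|` D ord_max = D0 -> forall i, D i `<=` D0.
Proof.
move=> <- [[|[|//]] lti] t Dt.
  by left; rewrite (_ : ord0 = Ordinal lti) //; apply: val_inj.
by right; rewrite (_ : ord_max = Ordinal lti) //; apply: val_inj.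
Qed.

Arguments part_sub {R D0 D} Dcov i : rename.

(* Orthogonal system of nonzero elements starting with the constant 1. *)
Definition ortho_system (R : realType) (D : set R) (E : funIPS D) (nu : nat)
    (Pi : 'I_nu.+1 -> D -> R) : Prop :=
  [/\ forall k, Pi k \in carrier E,
      forall k, Pi k <> cst 0,
      forall k l, k != l -> ip E (Pi k) (Pi l) = 0
    & Pi ord0 = cst 1].

Definition posdefmx (R : realType) (m : nat) (A : 'M[R]_m) : Prop :=
  A^T = A /\ forall x : 'cV[R]_m, x != 0 -> 0 < (x^T *m A *m x) 0 0.

Definition possemidefmx (R : realType) (m : nat) (A : 'M[R]_m) : Prop :=
  A^T = A /\ forall x : 'cV[R]_m, 0 <= (x^T *m A *m x) 0 0.

Definition He (R : realType) (m : nat) (A : 'M[R]_m) : 'M[R]_m := A + A^T.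

(* The dimensions have the shape required by the block matrix operators. *)
Definition M1 (nu n : nat) : nat := (\sum_(k < nu.+1) n)%N.
Definition M2 (nu n : nat) : nat := (\sum_(j < 2) M1 nu n)%N.

Lemma M1E nu n : M1 nu n = (nu.+1 * n)%N.
Proof. by rewrite /M1 sum_nat_const card_ord. Qed.

Lemma M2E nu n : M2 nu n = (2 * M1 nu n)%N.
Proof. by rewrite /M2 sum_nat_const card_ord. Qed.

Section Estimates.
Context {R : realType} {nu n : nat}.
Implicit Types (W : 'M[R]_n) (rho : 'I_nu.+1 -> R) (i : 'I_2).
Implicit Types (N : 'I_nu.+1 -> 'M[R]_(M2 nu n, n)) (chi : 'cV[R]_(M2 nu n)).
Implicit Types (Z : 'I_nu.+1 -> 'I_nu.+1 -> 'M[R]_(M2 nu n)).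

Definition wpart (D : set R) (E : funIPS D) (Pi : 'I_nu.+1 -> D -> R)
    (f : 'I_n -> D -> R) : 'cV[R]_(M1 nu n) :=
  \mxcol_(k < nu.+1) \col_(a < n) ip E (f a) (Pi k).

Definition wfull (w : 'I_2 -> 'cV[R]_(M1 nu n)) : 'cV[R]_(M2 nu n) :=
  \mxcol_(j < 2) w j.

Definition Nfull i N : 'M[R]_(M2 nu n) :=
  \mxrow_(j < 2) if j == i then \mxrow_(k < nu.+1) N k else 0.

Definition Psi W Z N :=
  block_mx (\mxblock_(k < nu.+1, l < nu.+1) Z k l) (\mxcol_(k < nu.+1) N k)
           (\mxrow_(k < nu.+1) (N k)^T)            W.

Definition calW W rho : 'M[R]_(M1 nu n) :=
  castmx (esym (M1E nu n), esym (M1E nu n))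
    (diag_mx (\row_k (rho k)^-1) *t W).

Definition calWhat W rho i : 'M[R]_(M2 nu n) :=
  \mxdiag_(j < 2) if j == i then invmx (calW W rho) else 0.

(* i enters only through N^i, placing the N_k in the i-th block of columns. *)
Definition R_GFMB rho i Z N chi (w : 'cV[R]_(M2 nu n)) : R :=
  (- (chi^T *m (\sum_k rho k *: Z k k) *m chi)
   - He (chi^T *m Nfull i N *m w)) 0 0.

Definition R_S W rho i N chi (w : 'cV[R]_(M2 nu n)) : R :=
  (- He (chi^T *m Nfull i N *m w)
   - chi^T *m Nfull i N *m calWhat W rho i *m (Nfull i N)^T *m chi) 0 0.

Definition R_BBI W rho (wi : 'cV[R]_(M1 nu n)) : R :=
  (wi^T *m calW W rho *m wi) 0 0.

End Estimates.

Lemma calWE (R : realType) (nu n : nat) (W : 'M[R]_n) (rho : 'I_nu.+1 -> R) :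
  calW W rho = \mxdiag_(k < nu.+1) ((rho k)^-1 *: W).
Proof.
rewrite -[calW W rho]submxblockK; apply/eq_mxblockP => k l.
have castR (j : 'I_nu.+1) (b : 'I_n) : cast_ord (M1E nu n)
    (@tagnat.Rank nu.+1 (fun=> n) j b) = mxtens_index (j, b).
  apply: val_inj; rewrite [LHS]tagnat.RankEsum /=; congr (_ + _)%N.
  rewrite sum_nat_const; congr (_ * _)%N.
  have /= jlt := ltnW (ltn_ord j).
  by rewrite -sum1_card -(big_ord_widen _ (fun=> 1%N) jlt) sum1_card card_ord.
apply/matrixP => a b; rewrite !mxE castmxE !esymK !castR tensmxE !mxE.
by case: eqVneq => [->|_]; rewrite ?conform_mx_id !mxE ?mulr1n // mulr0n mul0r.
Qed.

(* Main.v *)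
(* Let y_k be the coefficient vectors of f_i. Testing Psi >= 0 on the vector with
   chi in the k-th block, y_k / rho_k in the last block and 0 elsewhere, then
   multiplying by rho_k and summing over k, gives R_GFMB <= R_BBI. The choice
   Z_kl = N_k W^-1 N_l^T is admissible and turns R_GFMB into R_S. For this choice
   equality holds when N_k^T chi = - W y_k / rho_k for all k, which is achieved
   by a unit vector chi and N_k = - chi y_k^T W / rho_k. *)
Require Import Defs.
From HB Require Import structures.
From mathcomp Require Import all_boot all_order all_algebra.
From mathcomp Require Import mathcomp_extra boolp classical_sets functions reals.

Set Implicit Arguments.
Unset Strict Implicit.
Unset Printing Implicit Defensive.

Import Order.TTheory GRing.Theory Num.Theory.
Local Open Scope classical_set_scope.
Local Open Scope ring_scope.

Lemma posdefmx_unit (R : realType) (m : nat) (A : 'M[R]_m) :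
  posdefmx A -> A \in unitmx.
Proof.
move=> [_ Apos]; rewrite unitmxE unitfE; apply/det0P => -[v v0 vA].
have /Apos : v^T != 0 by rewrite -trmx0 (inj_eq trmx_inj).
by rewrite trmxK vA mul0mx mxE ltxx.
Qed.

Lemma posdefmx_ge0 (R : realType) (m : nat) (A : 'M[R]_m) (x : 'cV[R]_m) :
  posdefmx A -> 0 <= (x^T *m A *m x) 0 0.
Proof.
move=> [_ Apos]; have [->|/Apos/ltW//] := eqVneq x 0.
by rewrite mulmx0 mxE.
Qed.

Lemma possemidefmx_congr (R : realType) (m p : nat) (A : 'M[R]_m)
    (B : 'M[R]_(m, p)) : posdefmx A -> possemidefmx (B^T *m A *m B).
Proof.
move=> Apos; split=> [|x]; first by rewrite !trmx_mul trmxK Apos.1 mulmxA.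
by have := posdefmx_ge0 (B *m x) Apos; rewrite trmx_mul !mulmxA.
Qed.

Lemma quad_block_mx (R : realType) (m p : nat) (A : 'M[R]_m) (B : 'M[R]_(m, p))
    (C : 'M[R]_p) (x : 'cV[R]_m) (y : 'cV[R]_p) :
  ((col_mx x y)^T *m block_mx A B B^T C *m col_mx x y) 0 0 =
  (x^T *m A *m x) 0 0 + 2 * (x^T *m B *m y) 0 0 + (y^T *m C *m y) 0 0.
Proof.
have sym : y^T *m B^T *m x = (x^T *m B *m y)^T.
  by rewrite !trmx_mul trmxK mulmxA.
rewrite tr_col_mx mul_row_block mul_row_col !mulmxDl sym !mxE.
by rewrite mulr_natl mulr2n !addrA; congr (_ + _); rewrite addrAC.
Qed.

Lemma scalemx00 (R : realType) (a : R) (A : 'M[R]_1) :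
  (a *: A) 0 0 = a * A 0 0.
Proof. by rewrite mxE. Qed.

(** This follows from definiteness of the inner product. With the lower bounds on [rho] it makes
    every [rho k] positive, which the matrix estimates require. *)
Lemma ortho_system_norm_gt0 (R : realType) (D : set R) (E : funIPS D) (nu : nat)
    (Pi : 'I_nu.+1 -> D -> R) k :
  ortho_system E Pi -> 0 < ipnorm E (Pi k) ^+ 2.
Proof.
move=> [PiE Pi0 _ _]; have ip0 := ip_ge0 (PiE k).
rewrite /ipnorm sqr_sqrtr// lt_neqAle ip0 andbT eq_sym.
by apply: contra_not_neq (Pi0 k) => /(ip_def (PiE k)).
Qed.

Section Estimates.
Variables (R : realType) (nu n : nat) (i : 'I_2).
Variables (W : 'M[R]_n) (rho : 'I_nu.+1 -> R).
Hypotheses (Wpos : posdefmx W) (rho_gt0 : forall k, 0 < rho k).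
Variables (w : 'I_2 -> 'cV[R]_(M1 nu n)) (y : 'I_nu.+1 -> 'cV[R]_n).
Hypothesis wE : w i = \mxcol_k y k.
Implicit Types (Z : 'I_nu.+1 -> 'I_nu.+1 -> 'M[R]_(M2 nu n)).
Implicit Types (N : 'I_nu.+1 -> 'M[R]_(M2 nu n, n)) (chi : 'cV[R]_(M2 nu n)).

(** The blocks of [Nfull i N] outside position [i] vanish, so only the part [w i] of [wfull w]
    survives. *)
Lemma Nfull_wfull N : Nfull i N *m wfull w = \sum_k N k *m y k.
Proof.
rewrite /Nfull /wfull mul_mxrow_mxcol (big_only1 i) ?eqxx//; last first.
  by move=> j /negPf -> _; rewrite mul0mx.
by rewrite wE mul_mxrow_mxcol.
Qed.

Lemma R_BBIE : R_BBI W rho (w i) = \sum_k (rho k)^-1 * ((y k)^T *m W *m y k) 0 0.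
Proof.
rewrite /R_BBI wE calWE tr_mxcol mul_mxrow_mxdiag mul_mxrow_mxcol summxE.
by apply: eq_bigr => k _; rewrite -scalemxAr -scalemxAl mxE.
Qed.

(** This splits the estimate over [k], in the same way as [R_BBIE], so that the two can be compared
    term by term. *)
Lemma R_GFMBE Z N chi :
  R_GFMB rho i Z N chi (wfull w) =
  - \sum_k (rho k * (chi^T *m Z k k *m chi) 0 0
            + 2 * (chi^T *m N k *m y k) 0 0).
Proof.
have entry (A B : 'M[R]_1) : (- A - He B) 0 0 = - (A 0 0 + 2 * B 0 0).
  by rewrite !mxE mulr_natl mulr2n !opprD.
rewrite /R_GFMB entry -[chi^T *m _ *m wfull w]mulmxA Nfull_wfull.
rewrite big_split -mulr_sumr /= !mulmx_sumr mulmx_suml !summxE.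
congr (- (_ + 2 * _)); apply: eq_bigr => k _; last by rewrite mulmxA.
by rewrite -scalemxAr -scalemxAl mxE.
Qed.

(* With these Z_kl the Schur complement of W in Psi vanishes. *)
Definition Zschur N k l : 'M[R]_(M2 nu n) := N k *m invmx W *m (N l)^T.

Lemma invmx_calW : invmx (calW W rho) = \mxdiag_(k < nu.+1) (rho k *: invmx W).
Proof.
have calWV : calW W rho *m \mxdiag_(k < nu.+1) (rho k *: invmx W) = 1%:M.
  rewrite calWE {2}/mxdiag mul_mxdiag_mxblock -mxdiagZ.
  apply/eq_mxblockP => k l; rewrite !conform_mx_id.
  case: (k == l); last by rewrite mulmx0.
  rewrite -scalemxAl -scalemxAr mulmxV ?posdefmx_unit//.
  by rewrite scalerA mulVf ?scale1r// lt0r_neq0.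
by rewrite -[RHS](mulKmx (mulmx1_unit calWV).1) calWV mulmx1.
Qed.

(** Since [calW W rho] has the block diagonal inverse with blocks [rho k *: invmx W], the quadratic
    terms of both estimates coincide. *)
Lemma R_SE N chi :
  R_S W rho i N chi (wfull w) = R_GFMB rho i (Zschur N) N chi (wfull w).
Proof.
have NWN : Nfull i N *m calWhat W rho i *m (Nfull i N)^T =
    \sum_k rho k *: Zschur N k k.
  rewrite /Nfull /calWhat tr_mxrow mul_mxrow_mxdiag mul_mxrow_mxcol.
  rewrite (big_only1 i) ?eqxx//; last first.
    by move=> j /negPf -> _; rewrite !mul0mx.
  rewrite invmx_calW tr_mxrow mul_mxrow_mxdiag mul_mxrow_mxcol.
  by apply: eq_bigr => k _; rewrite -scalemxAr -scalemxAl.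
rewrite /R_S /R_GFMB addrC -NWN.
by rewrite !mulmxA.
Qed.

Lemma Psi_schur_ge0 N : possemidefmx (Psi W (Zschur N) N).
Proof.
pose V := invmx W; have [Wu Wsym] := (posdefmx_unit Wpos, Wpos.1).
have Vsym : V^T = V by rewrite trmx_inv Wsym.
(* Writing N for the column of the [N k], this is Y = W^-1 [N^T, W]. Hence Y^T W Y = [N; W] W^-1
   [N^T, W], whose blocks are N W^-1 N^T, N, N^T and W. *)
pose Y := V *m row_mx (\mxrow_(k < nu.+1) (N k)^T) W.
have -> : Psi W (Zschur N) N = Y^T *m W *m Y.
  rewrite /Y trmx_mul tr_row_mx Vsym Wsym !mulmxA mulmxKV//.
  rewrite mul_col_mx mul_col_row mulmxV// !mul1mx tr_mxrow mxcol_mul.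
  rewrite mul_mxcol_mxrow mxcol_mul /Psi.
  congr block_mx; first by apply/eq_mxblockP => k l; rewrite trmxK.
  by apply/eq_mxcolP => k; rewrite trmxK -mulmxA mulVmx// mulmx1.
exact: possemidefmx_congr.
Qed.

(** A test vector supported on the [k]-th and last blocks sees only the diagonal block [Z k k], the
    kind that enters [R_GFMB]. The last block [x] stays free, to be scaled later. *)
Lemma Psi_quad_ge0 Z N chi (x : 'cV[R]_n) k : possemidefmx (Psi W Z N) ->
  0 <= (chi^T *m Z k k *m chi) 0 0 + 2 * (chi^T *m N k *m x) 0 0
       + (x^T *m W *m x) 0 0.
Proof.
move=> [_ /(_ (col_mx (\mxcol_j (if j == k then chi else 0)) x))].
rewrite /Psi -tr_mxcol quad_block_mx tr_mxcol mul_mxrow_mxblock !mul_mxrow_mxcol.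
(* Three sums collapse to index [k]: the column sum and the row sum of the [Z] term, then the sum of
   the cross term. *)
rewrite (big_only1 k) ?eqxx//; last first.
  by move=> j /negPf -> _; rewrite mulmx0.
rewrite (big_only1 k) ?eqxx//; last first.
  by move=> j /negPf -> _; rewrite trmx0 mul0mx.
by rewrite (big_only1 k) ?eqxx// => j /negPf -> _; rewrite trmx0 mul0mx.
Qed.

Lemma R_GFMB_le Z N chi : possemidefmx (Psi W Z N) ->
  R_GFMB rho i Z N chi (wfull w) <= R_BBI W rho (w i).
Proof.
move=> Psi0; rewrite -subr_ge0 R_GFMBE R_BBIE opprK -big_split /=.
apply: sumr_ge0 => k _; have r0 := rho_gt0 k.
(* With this [x], multiplication by [rho k] removes the scaling from the cross term and leaves one
   factor [(rho k)^-1] on the [W] term, as in [R_BBI]. *)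
have := mulr_ge0 (ltW r0) (Psi_quad_ge0 chi ((rho k)^-1 *: y k) k Psi0).
rewrite [(_ *: _)^T]linearZ /= -!scalemxAl -!scalemxAr.
rewrite !scalemx00.
by rewrite !mulrDr [rho k * (2 * _)]mulrCA !mulVKf ?lt0r_neq0// [leRHS]addrC.
Qed.

Lemma R_GFMB_eq : (0 < n)%N -> exists N chi,
  R_GFMB rho i (Zschur N) N chi (wfull w) = R_BBI W rho (w i).
Proof.
(* A unit vector [chi] needs a nonempty index set, hence [0 < n]. *)
move=> n0; have M2_gt0 : (0 < M2 nu n)%N by rewrite M2E M1E !muln_gt0 n0.
pose chi : 'cV[R]_(M2 nu n) := delta_mx (Ordinal M2_gt0) 0.
have chi1 : chi^T *m chi = 1%:M.
  apply/matrixP => a b; rewrite !ord1 trmx_delta mul_delta_mx !mxE.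
  by rewrite !eqxx.
pose c k := - (rho k)^-1 *: ((y k)^T *m W).
exists (fun k => chi *m c k), chi.
have [Wu Wsym] := (posdefmx_unit Wpos, Wpos.1).
rewrite R_GFMBE R_BBIE -sumrN; apply: eq_bigr => k _.
have cW : c k *m invmx W = - (rho k)^-1 *: (y k)^T.
  by rewrite /c -scalemxAl mulmxK.
have cT : (c k)^T = - (rho k)^-1 *: (W *m y k).
  by rewrite [LHS]linearZ /= trmx_mul trmxK Wsym.
(* With q = y_k^T W y_k, the [Z] term becomes q / rho_k and the cross term -2 q / rho_k, so the
   negated sum is q / rho_k. *)
rewrite /Zschur trmx_mul !mulmxA chi1 mul1mx cW cT -!mulmxA chi1 mulmx1 /c.
rewrite -!scalemxAl -!scalemxAr !mulmxA.
rewrite !scalemx00 !(mulNr, mulrN) opprK mulVKf ?lt0r_neq0//.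
by rewrite mulr_natl mulr2n opprB addrK.
Qed.

End Estimates.

Theorem theorem10 (R : realType) (D0 : set R) (D : 'I_2 -> set R)
    (Ddisj : D ord0 `&` D ord_max = set0)
    (Dcov : D ord0 `|` D ord_max = D0)
    (E0 : funIPS D0) (E : forall j : 'I_2, funIPS (D j))
    (Erestr : forall (j : 'I_2) (u : D0 -> R), u \in carrier E0 ->
       restr (part_sub Dcov j) u \in carrier (E j))
    (Eip : forall u v : D0 -> R, u \in carrier E0 -> v \in carrier E0 ->
       ip E0 u v = \sum_(j < 2) ip (E j) (restr (part_sub Dcov j) u)
                                         (restr (part_sub Dcov j) v))
    (nu n : nat) (n_gt0 : (0 < n)%N)
    (Pi : forall j : 'I_2, 'I_nu.+1 -> D j -> R)
    (Pi_ortho : forall j : 'I_2, ortho_system (E j) (Pi j))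
    (i : 'I_2) (W : 'M[R]_n) (Wpos : posdefmx W)
    (rho : 'I_nu.+1 -> R)
    (rho_ge : forall k, ipnorm (E i) (Pi i k) ^+ 2 <= rho k)
    (f : 'I_n -> D0 -> R) (fE : forall a, f a \in carrier E0) :
  let wi (j : 'I_2) :=
    wpart (E j) (Pi j) (fun a => restr (part_sub Dcov j) (f a)) in
  let w := wfull wi in
  ((forall (Z : 'I_nu.+1 -> 'I_nu.+1 -> 'M[R]_(M2 nu n))
           (N : 'I_nu.+1 -> 'M[R]_(M2 nu n, n)) (chi : 'cV[R]_(M2 nu n)),
      possemidefmx (Psi W Z N) ->
      R_GFMB rho i Z N chi w <= R_BBI W rho (wi i)) /\
   (exists (Z : 'I_nu.+1 -> 'I_nu.+1 -> 'M[R]_(M2 nu n))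
           (N : 'I_nu.+1 -> 'M[R]_(M2 nu n, n)) (chi : 'cV[R]_(M2 nu n)),
      possemidefmx (Psi W Z N) /\
      R_GFMB rho i Z N chi w = R_BBI W rho (wi i)))
  /\
  ((forall (N : 'I_nu.+1 -> 'M[R]_(M2 nu n, n)) (chi : 'cV[R]_(M2 nu n)),
      R_S W rho i N chi w <= R_BBI W rho (wi i)) /\
   (exists (N : 'I_nu.+1 -> 'M[R]_(M2 nu n, n)) (chi : 'cV[R]_(M2 nu n)),
      R_S W rho i N chi w = R_BBI W rho (wi i))).
Proof.
move=> wi w.
have rho_gt0 k : 0 < rho k.
  exact: lt_le_trans (ortho_system_norm_gt0 k (Pi_ortho i)) (rho_ge k).
have wiE : wi i = \mxcol_(k < nu.+1) \col_(a < n)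
    ip (E i) (restr (part_sub Dcov i) (f a)) (Pi i k) by [].
have [N [chi GFMBE]] := R_GFMB_eq Wpos rho_gt0 wiE n_gt0.
split; split.
- by move=> Z N' chi'; exact: (R_GFMB_le rho_gt0 wiE).
- by exists (Zschur W N), N, chi; split=> //; exact: Psi_schur_ge0.
(* Every S-GFMB value is a GFMB value at an admissible matrix, so it inherits the bound; the same
   [N] and [chi] attain both equalities. *)
- move=> N' chi'; rewrite R_SE//.
  exact: (R_GFMB_le rho_gt0 wiE _ (Psi_schur_ge0 Wpos N')).
- by exists N, chi; rewrite R_SE.
Qed.
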